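(* Let $p_1,\dots,p_n$ be p-values for hypotheses $H_1,\dots,H_n$, let $\mathcal H_0\subseteq[n]$ be the set of null hypotheses, and let $p_{(1)}\le\dots\le p_{(n)}$ denote the sorted p-values. For $k\in[n]$ let $$\mathcal R_k \equiv \{j\in[n]: p_j\le p_{(k)}\},\qquad \overline V_{\mathrm{sort}}(\mathcal R_k)\equiv\left\lfloor \frac{\log(\frac1\alpha)}{\log\left(1+\log(\frac1\alpha)\right)}\cdot\left(1+n\cdot p_{(k)}\right)\right\rfloor,\qquad \overline{\mathrm{FDP}}_{\mathrm{sort}}(\mathcal R_k)\equiv\frac{\overline V_{\mathrm{sort}}(\mathcal R_k)}{|\mathcal R_k|}.$$ If the null p-values $(p_j)_{j\in\mathcal H_0}$ are independent and stochastically larger than uniform, i.e. $\Pr\{p_j\le s\}\le s$ for all $j\in\mathcal H_0$ and $s\in[0,1]$, then for all $\alpha\in(0,0.31]$, $$\Pr\left\{\mathrm{FDP}(\mathcal R_k)\le\overline{\mathrm{FDP}}_{\mathrm{sort}}(\mathcal R_k)\ \text{for all } k\in[n]\right\}\ge 1-\alpha.$$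
   Context: $[n]=\{1,\dots,n\}$. The p-values are $[0,1]$-valued random variables on a common probability space and $\mathcal H_0$ is a fixed (nonrandom) subset of $[n]$. For $\mathcal R\subseteq[n]$, the false discovery proportion is $\mathrm{FDP}(\mathcal R)\equiv|\mathcal R\cap\mathcal H_0|/|\mathcal R|$, with $\mathrm{FDP}(\varnothing)\equiv0$. No assumption is made on the non-null p-values or on their dependence with the null p-values. $\lfloor\cdot\rfloor$ is the floor function and $\log$ is the natural logarithm. *)

(* Defs.v *)
From HB Require Import structures.
From mathcomp Require Import all_boot all_order all_algebra.
From mathcomp Require Import all_classical all_reals all_analysis.

Set Implicit Arguments.
Unset Strict Implicit.
Unset Printing Implicit Defensive.
Import Order.TTheory GRing.Theory Num.Theory.
Import numFieldNormedType.Exports.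

Local Open Scope classical_set_scope.
Local Open Scope ring_scope.

(* Mutual independence of the subfamily (X j), j \in K: the product rule
   holds for every subset J of K and all measurable events. *)
Definition mutually_independent (d d' : measure_display)
    (T : measurableType d) (T' : measurableType d') (R : realType)
    (P : probability T R) (I : finType) (K : {set I})
    (X : I -> {RV P >-> T'}) : Prop :=
  forall (J : {set I}) (A : I -> set T'),
    J \subset K -> (forall j, measurable (A j)) ->
    P (\bigcap_(j in [set` J]) X j @^-1` A j) =
    (\prod_(j in J) P (X j @^-1` A j))%E.

Section SortedPath.
Context {R : realType} {n : nat}.
Implicit Types (x : 'I_n -> R) (k : 'I_n) (S : {set 'I_n}) (alpha : R).

(* Indices start at 0: [order_stat x k] is the (k+1)-st smallest entry of x,
   counted with multiplicity. *)
Definition order_stat x k : R := nth 0 (sort <=%R (codom x)) k.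

Definition rejection x k : {set 'I_n} :=
  [set j : 'I_n | x j <= order_stat x k]%SET.

(* The value on the empty set is 0, since 0^-1 = 0. *)
Definition FDP (H0 : {set 'I_n}) S : R := #|S :&: H0|%:R / #|S|%:R.

Definition Vbar_sort alpha x k : int :=
  Num.floor (ln (1 / alpha) / ln (1 + ln (1 / alpha)) *
             (1 + n%:R * order_stat x k)).

Definition FDPbar_sort alpha x k : R :=
  (Vbar_sort alpha x k)%:~R / #|rejection x k|%:R.

End SortedPath.

(* Main.v *)
Require Import Defs.
From mathcomp Require Import all_boot all_order all_algebra.
From mathcomp Require Import all_classical all_reals all_analysis.
From mathcomp Require Import ring lra.

Set Implicit Arguments.
Unset Strict Implicit.
Unset Printing Implicit Defensive.
Import Order.TTheory GRing.Theory Num.Theory.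
Import numFieldNormedType.Exports.
Local Open Scope classical_set_scope.
Local Open Scope ring_scope.

(** Write [L = ln (1 / alpha)], [theta = ln (1 + L)] and [x = L / theta], so
    that [expR theta = 1 + theta * x].  Every order statistic is one of the
    p-values, so the claim is that with probability at least [1 - alpha] the
    number of null p-values below [t] stays under the line [x * (1 + n * t)],
    for every [t] that is itself a p-value.

    For a Poisson process [N] of rate [m], [expR (theta * N t - theta * x * m * t)]
    is a martingale, and it starts at 1 and is at least [expR (theta * x) = 1 / alpha]
    where [N] meets the line [x * (1 + m * t)]; so the Poisson process meets the
    line with probability at most [alpha].  The counting process of [m]
    independent uniform variables is the Poisson process conditioned on having
    [m] points in [[0, 1]].  On the events known at time [t], its density with
    respect to the Poisson process is, when [N] points have appeared,
      [D t N = m ^_ N / m ^+ N * (1 - t) ^+ (m - N) * expR (m * t)].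
    Dividing a Poisson martingale by [D] gives a supermartingale for the
    uniform variables ([bridge_potential]).  The argument survives the division
    because [D <= 1] on and above the line ([density_le1]): there [N] exceeds
    [m * t] by so much that being conditioned to return to [m] at time 1 only
    makes the position less likely.  This holds as soon as [x >= 3 / 2], which
    is what [alpha <= 31 / 100] provides ([ratio_ge_three_halves]).

    Two reductions lead to uniform variables observed at finitely many times.
    The count is an integer, so if it exceeds the line at some [t] then it has
    already reached the level [k] at the time [threshold n x k] at which the
    line reaches [k]; only the [n] thresholds matter, and each p-value may be
    replaced by the index of the cell between thresholds that contains it.
    Crossing is a decreasing event of these indices, so by independence the
    super-uniform laws may be replaced one coordinate at a time by the uniform
    one, which only increases its probability ([prod_mean_dominated]).  Here [m]
    is the number of nulls, and having [n >= m] in the line only raises it.  The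
    maximal inequality is then proved by adding the thresholds one at a time
    ([mean_stopped_potential_le]). *)

(** * Elementary inequalities *)

Lemma one_sub_le_expR (R : realType) (u : R) :
  0 <= u <= 1 -> 1 - u <= expR (- u - u ^+ 2 / 2).
Proof.
case/andP=> u0 u1.
pose g (v : R) : R := (1 - v) * expR (v + v ^+ 2 / 2).
have dg (v : R) : is_derive v (1 : R) g (- v ^+ 2 * expR (v + v ^+ 2 / 2)).
  rewrite /g; apply: is_derive_eq.
  by rewrite /GRing.scale /=; set e := expR _; field.
have : g u <= g 0.
  apply: (@ler0_derive1_le_cc R g 0 1); rewrite ?in_itv /= ?lexx ?ler01 ?u0 //.
  - by move=> x _; rewrite derive1E (@derive_val _ _ _ _ _ _ _ (dg x))
      mulNr oppr_le0 mulr_ge0 ?sqr_ge0 ?expR_ge0.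
  - apply: derivable_within_continuous => x _.
    by have [] := dg x.
rewrite /g expr0n /= subr0 mul0r addr0 expR0 mulr1.
rewrite -opprD expRN -ler_pdivlMr ?expR_gt0 //.
by rewrite div1r.
Qed.

(** The exponent is the sum of [i / m + (i / m) ^+ 2 / 2] over [i < k]. *)
Lemma ffact_le_expR (R : realType) (m k : nat) : (k <= m)%N -> (0 < m)%N ->
  (m ^_ k)%:R <= m%:R ^+ k *
    expR (- (k%:R * (k%:R - 1) / (2 * m%:R)
             + (k%:R - 1) * k%:R * (2 * k%:R - 1) / (12 * m%:R ^+ 2))) :> R.
Proof.
move=> km m0; have m0R : 0 < m%:R :> R by rewrite ltr0n.
elim: k km => [|k IH] km.
  by rewrite ffactn0 expr0 !(mul0r, mulr0) addr0 oppr0 expR0 mulr1.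
rewrite ffactnSr natrM.
have kE : (m - k)%N%:R = m%:R * (1 - k%:R / m%:R) :> R.
  by rewrite natrB 1?ltnW //; field; rewrite gt_eqF.
have hk : (m - k)%N%:R <= m%:R * expR (- (k%:R / m%:R) - (k%:R / m%:R) ^+ 2 / 2) :> R.
  rewrite kE ler_pM2l //; apply: one_sub_le_expR.
  by rewrite divr_ge0 //= ler_pdivrMr // mul1r ler_nat ltnW.
apply: (le_trans (ler_pM _ _ (IH (ltnW km)) hk)) => //.
rewrite mulrACA -exprSr -expRD ler_pM2l ?exprn_gt0 // ler_expR -natr1.
by rewrite le_eqVlt; apply/orP; left; apply/eqP; field; rewrite gt_eqF.
Qed.

(** With [l = m * t], twice [m] times the left-hand side is
    [k - (k - l) ^+ 2 + (k / m) * X] for an [X] that can have either sign.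
    It is affine in [k / m], so it suffices to look at the values 0 and 1 of
    that ratio; both follow from [l <= 2 / 3 * k - 1]. *)
Lemma density_exponent_le0 (R : realType) (m k t : R) :
  0 < m -> k <= m -> 0 <= t -> 3 / 2 * (1 + m * t) <= k ->
  m * t + (m - k) * (- t - t ^+ 2 / 2) -
    (k * (k - 1) / (2 * m) + (k - 1) * k * (2 * k - 1) / (12 * m ^+ 2)) <= 0.
Proof.
move=> m0 km t0 kt.
pose l := m * t.
have l0 : 0 <= l by rewrite mulr_ge0 // ltW.
have lk : l <= 2 / 3 * k - 1 by rewrite /l; lra.
pose X := l ^+ 2 - (k - 1) * (2 * k - 1) / 6.
have k0 : 0 <= k by rewrite /l in l0 *; lra.
have e : m * t + (m - k) * (- t - t ^+ 2 / 2) -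
    (k * (k - 1) / (2 * m) + (k - 1) * k * (2 * k - 1) / (12 * m ^+ 2))
    = (k - (k - l) ^+ 2 + k / m * X) / (2 * m).
  by rewrite /X /l; field; rewrite gt_eqF.
rewrite e pmulr_lle0 ?invr_gt0 ?mulr_gt0 //.
have r1 : 0 <= k / m <= 1 by rewrite divr_ge0 ?(ltW m0) //= ler_pdivrMr // mul1r.
have h1 : k - (k - l) ^+ 2 <= 0.
  have : (k / 3 + 1) ^+ 2 <= (k - l) ^+ 2 by apply: lerXn2r; rewrite ?nnegrE; lra.
  nra.
have h2 : k - (k - l) ^+ 2 + X <= 0 by rewrite /X; nra.
have [X0|X0] := lerP X 0; nra.
Qed.

(** The density at time [t] of the counting process of [m] uniform points with
    respect to the Poisson process of rate [m] is at most 1 once the count [k]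
    is above the line of slope [3 / 2].  Second-order bounds on the logarithms
    are needed: the first-order terms cancel when [k] is close to [m * t]. *)
Lemma density_le1 (R : realType) (m k : nat) (t : R) :
  (k <= m)%N -> 0 <= t < 1 -> 3 / 2 * (1 + m%:R * t) <= k%:R ->
  (m ^_ k)%:R * (1 - t) ^+ (m - k) * expR (m%:R * t) <= m%:R ^+ k :> R.
Proof.
move=> km /andP[t0 t1] kt.
have m0 : (0 < m)%N.
  rewrite lt0n; apply/eqP => m0; move: km kt; rewrite m0 leqn0 => /eqP ->.
  by rewrite mul0r; lra.
have m0R : 0 < m%:R :> R by rewrite ltr0n.
have h1 : (1 - t) ^+ (m - k) <= expR ((m%:R - k%:R) * (- t - t ^+ 2 / 2)).
  rewrite -natrB // mulrC expRM_natr; apply: lerXn2r; rewrite ?nnegrE ?expR_ge0 //.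
    by lra.
  by apply: one_sub_le_expR; rewrite t0 ltW.
have h2 := ffact_le_expR R km m0.
have t1' : 0 <= 1 - t by lra.
apply: (@le_trans _ _ (m%:R ^+ k * expR (m%:R * t + (m%:R - k%:R) * (- t - t ^+ 2 / 2) -
    (k%:R * (k%:R - 1) / (2 * m%:R)
     + (k%:R - 1) * k%:R * (2 * k%:R - 1) / (12 * m%:R ^+ 2))))).
  set C := (X in expR (_ - X)); rewrite -/C in h2.
  have -> (A B : R) : m%:R ^+ k * expR (A + B - C) =
      m%:R ^+ k * expR (- C) * expR B * expR A by rewrite !expRD; ring.
  by rewrite ler_pM2r ?expR_gt0 // ler_pM // exprn_ge0.
rewrite ler_piMr ?exprn_ge0 // expR_le1.
by apply: density_exponent_le0; rewrite ?ler_nat.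
Qed.

Lemma sum_exp_coeff_le_expR (R : realType) (x : R) m : 0 <= x ->
  \sum_(0 <= i < m) x ^+ i / i`!%:R <= expR x.
Proof.
move=> x0.
suff : series (exp_coeff x) m <= expR x by [].
apply: nondecreasing_cvgn_le; last exact: is_cvg_series_exp_coeff.
by apply: nondecreasing_series => n _ _; apply: exp_coeff_ge0.
Qed.

(** [L / ln (1 + L)] increases with [L] and passes [3 / 2] near [L = 1.142],
    whereas [ln (100 / 31)] is about [1.171]. *)
Lemma ratio_ge_three_halves (R : realType) (L : R) :
  100 / 31 <= expR L -> 3 / 2 * ln (1 + L) <= L.
Proof.
move=> hL.
(* The test point 1.15 satisfies both exp 1.15 <= 100/31 and 3 ln 2.15 <= 2.3;
   beyond it the tangent of ln at 2.15 has slope less than 2/3. *)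
have L0 : 115 / 100 <= L.
  rewrite -ler_expR; apply: le_trans hL.
  (* 0.135 + 0.135^2 / 2 is just above 1.15 / 8. *)
  have h0 : 865 / 1000 <= expR (- (115 / 800)) :> R.
    apply: le_trans (_ : expR (- (135 / 1000) - (135 / 1000) ^+ 2 / 2) <= _).
      apply: le_trans (one_sub_le_expR _); lra.
    by rewrite ler_expR; lra.
  have : 31 / 100 <= expR (- (115 / 100)) :> R.
    have -> : - (115 / 100) = 8%:R * - (115 / 800) :> R by field.
    rewrite expRM_natl; apply: le_trans (_ : (865 / 1000) ^+ 8 <= _); first by lra.
    have pw (a b : R) n : 0 <= a -> a <= b -> a ^+ n <= b ^+ n.
      by move=> a0 ab; rewrite lerXn2r // nnegrE (le_trans a0 ab).
    by apply: pw h0; lra.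
  move/(ler_wpM2l (expR_ge0 (115 / 100 : R))).
  by rewrite expRxMexpNx_1; lra.
have ln0 : ln (215 / 100) <= 23 / 30 :> R.
  rewrite -ler_expR lnK ?posrE; last by lra.
  have := @sum_exp_coeff_le_expR R (23 / 30) 6 ltac:(lra).
  by apply: le_trans; rewrite !big_nat_recl // big_geq // !factS fact0 !natrM; lra.
have -> : 1 + L = 215 / 100 * (1 + (L - 115 / 100) / (215 / 100)) by field.
have q0 : 0 <= (L - 115 / 100) / (215 / 100) by lra.
rewrite lnM ?posrE; [|lra|lra].
have := @le_ln1Dx R ((L - 115 / 100) / (215 / 100)) ltac:(lra).
by lra.
Qed.

(** * Means under products of finite laws *)

Section FiniteProducts.
Variable R : realType.
Implicit Types (K : nat) (mu nu : nat -> R) (l : seq (nat -> R)) (g : seq nat -> R).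

(** The mean of [g] over independent draws from the laws [l], each supported in
    [0..K].  The recursion on the list of laws lets both the replacement of one
    law and the refinement of the cells proceed by induction on coordinates. *)
Fixpoint prod_mean K l g : R :=
  if l is mu :: l' then \sum_(0 <= y < K.+1) mu y * prod_mean K l' (fun b => g (y :: b))
  else g [::].

Lemma prod_mean_le K l g g' :
  (forall mu, mu \in l -> forall y, 0 <= mu y) ->
  (forall b, size b = size l -> all (leq^~ K) b -> g b <= g' b) ->
  prod_mean K l g <= prod_mean K l g'.
Proof.
elim: l g g' => [|mu l IH] g g' l0 gg' /=; first exact: gg'.
rewrite !big_nat; apply: ler_sum => y yK; apply: ler_wpM2l.
  by apply: l0; rewrite inE eqxx.
apply: IH => [nu nul|b sb bK]; first by apply: l0; rewrite inE nul orbT.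
by apply: gg' => /=; rewrite ?sb // bK andbT -ltnS.
Qed.

Lemma prod_mean_linear K l g g' (c c' : R) :
  prod_mean K l (fun b => c * g b + c' * g' b) = c * prod_mean K l g + c' * prod_mean K l g'.
Proof.
elim: l g g' => [|mu l IH] g g' //=.
rewrite !mulr_sumr -big_split /=; apply: eq_bigr => y _.
by rewrite IH; ring.
Qed.

(** Stochastic domination for a nonincreasing [f], by summation by parts. *)
Lemma sum_le_cdf K mu nu (f : nat -> R) :
  (forall y, (y < K)%N -> f y.+1 <= f y) ->
  (forall k, (k < K)%N ->
     \sum_(0 <= y < k.+1) mu y <= \sum_(0 <= y < k.+1) nu y) ->
  \sum_(0 <= y < K.+1) mu y = \sum_(0 <= y < K.+1) nu y ->
  \sum_(0 <= y < K.+1) mu y * f y <= \sum_(0 <= y < K.+1) nu y * f y.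
Proof.
move=> fdec cdf tot.
have abel (la : nat -> R) k : \sum_(0 <= y < k.+1) la y * f y =
    \sum_(0 <= i < k) (\sum_(0 <= y < i.+1) la y) * (f i - f i.+1)
    + (\sum_(0 <= y < k.+1) la y) * f k.
  elim: k => [|k IH]; first by rewrite !big_nat1 big_geq // add0r.
  rewrite big_nat_recr //= IH [in RHS]big_nat_recr //=.
  by rewrite [X in _ = _ + X * _]big_nat_recr //=; ring.
rewrite !abel tot lerD2r !big_nat; apply: ler_sum => i /andP[_ iK].
by apply: ler_wpM2r; rewrite ?subr_ge0 ?fdec ?cdf.
Qed.

(** With the other coordinates fixed or averaged out, [g] is nonincreasing in
    each coordinate, so the laws can be replaced by [nu] one after the other. *)
Lemma prod_mean_dominated K l nu g :
  (forall mu, mu \in l -> forall y, 0 <= mu y) -> (forall y, 0 <= nu y) ->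
  (forall mu, mu \in l -> forall k, (k < K)%N ->
     \sum_(0 <= y < k.+1) mu y <= \sum_(0 <= y < k.+1) nu y) ->
  (forall mu, mu \in l ->
     \sum_(0 <= y < K.+1) mu y = \sum_(0 <= y < K.+1) nu y) ->
  (forall (b b' : seq nat), all2 leq b b' -> g b' <= g b) ->
  prod_mean K l g <= prod_mean K (nseq (size l) nu) g.
Proof.
move=> + nu0; elim: l g => [//|mu l IH] g l0 cdf tot gdec /=.
have memS la : la \in l -> la \in mu :: l by rewrite inE orbC => ->.
have mem0 : mu \in mu :: l by rewrite inE eqxx.
have all2_refl (b : seq nat) : all2 leq b b by elim: b => //= a b ->; rewrite leqnn.
have nnu la m : la \in nseq m nu -> forall y, 0 <= la y.
  by rewrite mem_nseq => /andP[_ /eqP ->].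
apply: (@le_trans _ _
  (\sum_(0 <= y < K.+1) mu y * prod_mean K (nseq (size l) nu) (fun b => g (y :: b)))).
  apply: ler_sum => y _; apply: ler_wpM2l; first exact: l0.
  apply: IH => [la lal|la lal|la lal|b b' bb'].
  - exact/l0/memS.
  - exact/cdf/memS.
  - exact/tot/memS.
  - by apply: gdec; rewrite /= leqnn.
apply: sum_le_cdf => [y yK||]; [|exact: cdf|exact: tot].
apply: prod_mean_le => [la /nnu //|b _ _].
by apply: gdec; rewrite /= leqnSn all2_refl.
Qed.

(** The mean of [h] under the binomial law of [m] trials with success
    probability [q], computed trial by trial as [split_cells] below does. *)
Fixpoint binom_mean (q : R) (m : nat) (h : nat -> R) : R :=
  if m is m'.+1 then q * binom_mean q m' (fun i => h i.+1) + (1 - q) * binom_mean q m' h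
  else h 0%N.

Lemma binom_meanE q m h :
  binom_mean q m h = \sum_(0 <= i < m.+1) 'C(m, i)%:R * q ^+ i * (1 - q) ^+ (m - i) * h i.
Proof.
elim: m h => [|m IH] h; first by rewrite /= big_nat1 bin0 !expr0 !mul1r.
rewrite /= !IH.
pose u i := 'C(m, i)%:R * q ^+ i * (1 - q) ^+ (m.+1 - i) * h i.
have -> : \sum_(0 <= i < m.+2) 'C(m.+1, i)%:R * q ^+ i * (1 - q) ^+ (m.+1 - i) * h i
  = \sum_(0 <= i < m.+2) u i +
    \sum_(0 <= i < m.+1) 'C(m, i)%:R * q ^+ i.+1 * (1 - q) ^+ (m - i) * h i.+1.
  rewrite big_nat_recl // [in RHS]big_nat_recl // /u !bin0 -addrA; congr (_ + _).
  rewrite -big_split /=; apply: eq_bigr => i _.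
  by rewrite binS natrD subSS; ring.
rewrite [\sum_(0 <= i < m.+2) u i]big_nat_recr //= {2}/u bin_small // !mul0r addr0 addrC.
rewrite !mulr_sumr; congr (_ + _); rewrite !big_nat; apply: eq_bigr => i /andP[_ im].
  by rewrite /u subSn -1?ltnS // exprS; ring.
by rewrite exprS; ring.
Qed.

End FiniteProducts.

(** * Cells of a uniform variable and their refinement *)

Section UniformCells.
Variables (R : realType) (s : nat -> R).
Hypotheses (s0 : s 0%N = 0) (s_mono : forall k, s k <= s k.+1)
  (s_lt1 : forall k, s k < 1).
Implicit Types (K : nat) (b c : seq nat) (phi : seq nat -> R).

(** The law of the cell of a uniform variable, where cell [y < K] is the interval
    from [s y] to [s y.+1] and cell [K] is the rest of the unit interval. *)
Definition cell_law K (y : nat) : R := (if (y < K)%N then s y.+1 else 1) - s y.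

Lemma cell_law_ge0 K y : 0 <= cell_law K y.
Proof. by rewrite /cell_law subr_ge0; case: ifP => _; rewrite ?s_mono // ltW. Qed.

Lemma cell_law_cdf K k : (k < K)%N ->
  \sum_(0 <= y < k.+1) cell_law K y = s k.+1.
Proof.
elim: k => [|k IH] kK; first by rewrite big_nat1 /cell_law kK s0 subr0.
by rewrite big_nat_recr //= IH 1?ltnW // /cell_law kK addrC subrK.
Qed.

Lemma cell_law_total K : \sum_(0 <= y < K.+1) cell_law K y = 1.
Proof.
case: K => [|K]; first by rewrite big_nat1 /cell_law s0 subr0.
by rewrite big_nat_recr //= cell_law_cdf // /cell_law ltnn addrC subrK.
Qed.

(** Mean of [phi] when each entry [K] of [c] independently stays in cell [K] with
    probability [q] and moves to cell [K.+1] otherwise: the conditional mean,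
    given the cells cut by the first [K] thresholds, when the next one is added. *)
Fixpoint split_cells (q : R) K phi c : R :=
  if c is y :: c' then
    if (y < K)%N then split_cells q K (fun b => phi (y :: b)) c'
    else q * split_cells q K (fun b => phi (K :: b)) c'
         + (1 - q) * split_cells q K (fun b => phi (K.+1 :: b)) c'
  else phi [::].

Lemma prod_mean_refine K m phi (q := (s K.+1 - s K) / (1 - s K)) :
  prod_mean K.+1 (nseq m (cell_law K.+1)) phi
  = prod_mean K (nseq m (cell_law K)) (split_cells q K phi).
Proof.
elim: m phi => [//|m IH] phi /=.
rewrite big_nat_recr //= big_nat_recr //= [in RHS]big_nat_recr //= -addrA.
congr (_ + _).
  rewrite !big_nat; apply: eq_bigr => y /andP[_ yK].
  by rewrite IH yK /cell_law yK ltnS ltnW.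
rewrite !IH ltnn prod_mean_linear /cell_law ltnSn !ltnn /q.
by field; rewrite gt_eqF ?subr_gt0.
Qed.

Definition below k b := count (fun y => (y < k)%N) b.

(** Each entry [K] of [c] is one trial.  The hypothesis on [phi] ranges over all
    refinements [b] of [c], since truncating at [K] undoes the split. *)
Lemma split_cells_binom q K phi h c :
  all (leq^~ K) c ->
  (forall b, map (minn K) b = c -> phi b = h (below K.+1 b)) ->
  split_cells q K phi c = binom_mean q (count_mem K c) (fun i => h (below K c + i)%N).
Proof.
elim: c phi h => [|y c IH] phi h /=; first by move=> _ ->.
move=> /andP[yK cK] phih.
have [ltyK|geyK] := ltnP y K.
  rewrite ltn_eqF //= (IH _ (fun i => h i.+1)) // => b bc.
  by rewrite phih /= ?bc ?(minn_idPr _) // ltnS yK.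
have ? : y = K by apply/eqP; rewrite eqn_leq yK.
subst y.
rewrite eqxx /= add0n; congr (_ * _ + _ * _).
  rewrite (IH _ (fun i => h i.+1)) // => [|b bc].
    by congr binom_mean; apply/funext => i; rewrite addnS.
  by rewrite phih /= ?bc ?minnn // /below /= ltnSn add1n.
rewrite (IH _ h) // => b bc.
by rewrite phih /= ?bc ?(minn_idPl _) // /below /= ltnn add0n.
Qed.

End UniformCells.

(** * A supermartingale for uniform points *)

Section Potential.
Variable R : realType.

(** The Poisson martingale [a ^+ N * expR (- (a - 1) * m * t)] divided by the
    density [m ^_ N / m ^+ N * (1 - t) ^+ (m - N) * expR (m * t)] of the uniform
    counting process. *)
Definition bridge_potential (m : nat) (a t : R) (N : nat) : R :=
  (a * m%:R) ^+ N * expR (- (a * m%:R * t)) * (m - N)`!%:R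
  / ((1 - t) ^+ (m - N) * m`!%:R).

Lemma bridge_potential_ge0 m a t N : 0 <= a -> t < 1 -> 0 <= bridge_potential m a t N.
Proof.
move=> a0 t1; have d0 : 0 <= 1 - t by lra.
by rewrite /bridge_potential divr_ge0 ?mulr_ge0 ?exprn_ge0 ?mulr_ge0 ?expR_ge0.
Qed.

(** The supermartingale property: of the [j] points not seen before [t], each
    appears before [t'] with probability [q].  The factorials turn the binomial
    mean into a truncated exponential series with argument [a * m * (t' - t)],
    and the factor [expR (- (a * m * t))] compensates the full series. *)
Lemma bridge_potential_super m a t t' j (q := (t' - t) / (1 - t)) :
  0 <= a -> 0 <= t -> t <= t' -> t' < 1 -> (j <= m)%N ->
  binom_mean q j (fun i => bridge_potential m a t' (m - j + i)%N)
  <= bridge_potential m a t (m - j)%N.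
Proof.
move=> a0 t0 tt' t1 jm.
have D0 : 1 - t != 0 by rewrite gt_eqF //; lra.
have D'0 : 1 - t' != 0 by rewrite gt_eqF //; lra.
pose z := a * m%:R * (t' - t).
have z0 : 0 <= z by rewrite mulr_ge0 ?mulr_ge0 ?subr_ge0.
pose B := (a * m%:R) ^+ (m - j) * expR (- (a * m%:R * t')) * j`!%:R
            / ((1 - t) ^+ j * m`!%:R).
have -> : bridge_potential m a t (m - j) = B * expR z.
  have -> : bridge_potential m a t (m - j) = (a * m%:R) ^+ (m - j) *
      expR (- (a * m%:R * t') + z) * j`!%:R / ((1 - t) ^+ j * m`!%:R).
    by rewrite /bridge_potential subKn // /z; congr (_ * expR _ * _ / _); ring.
  by rewrite expRD /B; ring.
apply: le_trans (_ : B * \sum_(0 <= i < j.+1) z ^+ i / i`!%:R <= _); last first.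
  apply: ler_wpM2l; last exact: sum_exp_coeff_le_expR.
  have d0 : 0 <= 1 - t by lra.
  by rewrite /B divr_ge0 ?mulr_ge0 ?exprn_ge0 ?mulr_ge0 ?expR_ge0.
rewrite binom_meanE mulr_sumr le_eqVlt; apply/orP; left; apply/eqP.
rewrite !big_nat; apply: eq_bigr => i /andP[_]; rewrite ltnS => ij.
rewrite /bridge_potential /B /z subnDA subKn // exprD.
have -> : 1 - q = (1 - t') / (1 - t) by rewrite /q; field.
have -> : (1 - t) ^+ j = (1 - t) ^+ i * (1 - t) ^+ (j - i) by rewrite -exprD subnKC.
rewrite -(bin_fact ij) !natrM /q !exprMn !exprVn.
by field; rewrite !expf_neq0 ?pnatr_eq0 -?lt0n ?fact_gt0.
Qed.

(** On the line the Poisson martingale with [a = expR theta] is at least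
    [expR (theta * x)], and the density by which it is divided is at most 1. *)
Lemma bridge_potential_ge1 m (x theta t : R) N (L := theta * x) :
  3 / 2 <= x -> 0 <= theta -> expR theta = 1 + L -> 0 <= t < 1 -> (N <= m)%N ->
  x * (1 + m%:R * t) <= N%:R ->
  1 <= expR (- L) * bridge_potential m (1 + L) t N.
Proof.
move=> x32 th0 eth t01 Nm xN; have /andP[t0 t1] := t01.
have mt0 : 0 <= m%:R * t by rewrite mulr_ge0.
have dens := @density_le1 R m N t Nm t01 ltac:(nra).
have D0 : 0 < (1 - t) ^+ (m - N) by rewrite exprn_gt0 //; lra.
have ltN : expR (- (m%:R * t)) <=
    expR (- L) * (1 + L) ^+ N * expR (- ((1 + L) * m%:R * t)).
  rewrite -eth -expRM_natr -!expRD ler_expR eth.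
  suff : L * (1 + m%:R * t) <= theta * N%:R by rewrite /L; lra.
  by rewrite /L -mulrA ler_wpM2l.
have -> : expR (- L) * bridge_potential m (1 + L) t N =
  (expR (- L) * (1 + L) ^+ N * expR (- ((1 + L) * m%:R * t))) *
  (m%:R ^+ N / ((m ^_ N)%:R * (1 - t) ^+ (m - N))).
  rewrite /bridge_potential exprMn -(ffact_fact Nm) natrM.
  by field; rewrite ?gt_eqF ?pnatr_eq0 -?lt0n ?fact_gt0 ?ffact_gt0 ?ltr0n ?fact_gt0 ?ffact_gt0.
apply: le_trans (_ : expR (- (m%:R * t)) * expR (m%:R * t) <= _).
  by rewrite mulrC expRxMexpNx_1.
apply: ler_pM; rewrite ?expR_ge0 //.
by rewrite ler_pdivlMr ?mulr_gt0 ?ltr0n ?ffact_gt0 // mulrC.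
Qed.

End Potential.

(** * The crossing probability *)

Section Crossing.
Variables (R : realType) (s : nat -> R) (m : nat) (x theta : R).
Hypotheses (s0 : s 0%N = 0) (s_mono : forall k, s k <= s k.+1)
  (s_lt1 : forall k, s k < 1).
Hypotheses (x_ge : 3 / 2 <= x) (theta_ge0 : 0 <= theta)
  (theta_eq : expR theta = 1 + theta * x).
Implicit Types (K : nat) (b c : seq nat).

Definition reaches k (N : nat) : bool := x * (1 + m%:R * s k) <= N%:R.

Definition crossed K b := has (fun k => reaches k (below k b)) (iota 0 K.+1).

(** The potential, normalised to start at [expR (- (theta * x))] and frozen at
    the value 1 from the first crossing on. *)
Definition stopped_potential K b : R :=
  if crossed K b then 1
  else expR (- (theta * x)) * bridge_potential m (1 + theta * x) (s K) (below K b).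

Let s_ge0 k : 0 <= s k.
Proof. by elim: k => [|k /le_trans]; [rewrite s0|apply]. Qed.

Let a_ge0 : 0 <= 1 + theta * x.
Proof. by rewrite -theta_eq expR_ge0. Qed.

(** What happens up to the threshold [K] does not depend on how the last cell is
    subdivided. *)
Lemma crossed_trunc K b : crossed K (map (minn K) b) = crossed K b.
Proof.
apply: eq_in_has => k; rewrite mem_iota /= ltnS => kK; congr reaches.
rewrite /below count_map; apply: eq_count => y /=.
by rewrite gtn_min ltnNge kK.
Qed.

Lemma crossedS K b : crossed K.+1 b = crossed K b || reaches K.+1 (below K.+1 b).
Proof. by rewrite /crossed -addn1 iotaD has_cat /= orbF. Qed.

Lemma split_cells_stopped_potential K c (q := (s K.+1 - s K) / (1 - s K)) :
  size c = m -> all (leq^~ K) c ->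
  split_cells q K (fun b => if crossed K b then 1 else
    expR (- (theta * x)) * bridge_potential m (1 + theta * x) (s K.+1) (below K.+1 b)) c
  <= stopped_potential K c.
Proof.
move=> sc cK; rewrite /stopped_potential.
have cnt : (below K c + count_mem K c)%N = m.
  rewrite -sc -(count_predC (fun y => (y < K)%N) c); congr (_ + _)%N.
  by apply: eq_in_count => y /(allP cK) /= yK; rewrite -leqNgt eqn_leq yK.
have jm : (count_mem K c <= m)%N by rewrite -cnt leq_addl.
have binom_mean_scale (r e : R) j h : binom_mean r j (fun i => e * h i) = e * binom_mean r j h.
  by elim: j h => //= j IH h; rewrite !IH; ring.
case: ifPn => cr.
  rewrite (@split_cells_binom _ q K _ (fun=> 1) c cK).
    by elim: (count_mem _ _) => //= j IH; lra.
  by move=> b bc; rewrite -crossed_trunc bc cr.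
rewrite (@split_cells_binom _ q K _ (fun N => expR (- (theta * x)) *
    bridge_potential m (1 + theta * x) (s K.+1) N) c cK).
  rewrite binom_mean_scale ler_wpM2l ?expR_ge0 //.
  have -> : below K c = (m - count_mem K c)%N by rewrite -cnt addnK.
  exact: bridge_potential_super.
by move=> b bc; rewrite -crossed_trunc bc (negbTE cr).
Qed.

(** Adding a threshold does not increase the mean: a new crossing only replaces
    a potential that is at least 1 by the value 1, and otherwise the potential
    is a supermartingale. *)
Lemma mean_stopped_potential_le K :
  prod_mean K (nseq m (cell_law s K)) (stopped_potential K) <= expR (- (theta * x)).
Proof.
have nn K' mu : mu \in nseq m (cell_law s K') -> forall y, 0 <= mu y.
  by rewrite mem_nseq => /andP[_ /eqP -> y]; apply: cell_law_ge0.
elim: K => [|K IH].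
  apply: (@le_trans _ _ (prod_mean 0 (nseq m (cell_law s 0)) (fun=> expR (- (theta * x))))).
    apply: prod_mean_le (nn 0%N) _ => b sb b0.
    have lb : below 0 b = 0%N by rewrite /below; elim: b {sb b0} => //= y b ->.
    rewrite /stopped_potential /crossed /= orbF lb /reaches s0 mulr0 addr0 mulr1.
    case: ifPn => [h|_]; first by have := le_trans x_ge h; rewrite leNgt divr_gt0.
    rewrite ler_piMr ?expR_ge0 // /bridge_potential subn0 mulr0 oppr0 expR0.
    by rewrite addr0 !expr0 expr1n !mul1r divff // pnatr_eq0 -lt0n fact_gt0.
  elim: m => //= m' IH; rewrite big_nat1 /cell_law ltnn s0 subr0 mul1r.
  exact: IH.
apply: le_trans IH; pose phi b := if crossed K b then 1 else
  expR (- (theta * x)) * bridge_potential m (1 + theta * x) (s K.+1) (below K.+1 b).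
apply: (@le_trans _ _ (prod_mean K.+1 (nseq m (cell_law s K.+1)) phi)).
  apply: prod_mean_le (nn K.+1) _ => b; rewrite size_nseq => sb _.
  rewrite /stopped_potential /phi crossedS.
  case: (crossed K b) => //=; case: ifP => // cr.
  by apply: bridge_potential_ge1 => //; rewrite ?s_ge0 ?s_lt1 // -sb count_size.
rewrite prod_mean_refine //; apply: prod_mean_le (nn K) _ => c; rewrite size_nseq => sc cK.
exact: split_cells_stopped_potential.
Qed.

(** Lowering the cell indices raises every count, so a crossing persists and
    domination applies; for uniform cells the stopped potential bounds the
    indicator of crossing. *)
Lemma mean_crossed_le K (l : seq (nat -> R)) :
  size l = m -> (forall mu, mu \in l -> forall y, 0 <= mu y) ->
  (forall mu, mu \in l -> forall k, (k < K)%N ->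
     \sum_(0 <= y < k.+1) mu y <= s k.+1) ->
  (forall mu, mu \in l -> \sum_(0 <= y < K.+1) mu y = 1) ->
  prod_mean K l (fun b => (crossed K b)%:R) <= expR (- (theta * x)).
Proof.
move=> sl l0 cdf tot; apply: le_trans (mean_stopped_potential_le K).
apply: (@le_trans _ _ (prod_mean K (nseq m (cell_law s K)) (fun b => (crossed K b)%:R))).
  rewrite -sl; apply: prod_mean_dominated => //.
  - by move=> y; apply: cell_law_ge0.
  - by move=> mu mul k kK; rewrite cell_law_cdf // cdf.
  - by move=> mu mul; rewrite cell_law_total // tot.
  move=> b b' bb'; rewrite ler_nat.
  suff : crossed K b' -> crossed K b by do 2 case: crossed => //; move=> /(_ isT).
  move=> /hasP[k kK cr]; apply/hasP; exists k => //.
  rewrite /reaches (le_trans cr) // ler_nat /below.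
  elim: b b' bb' {cr} => [|y b IHb] [|y' b'] //= /andP[yy' bb'].
  apply: leq_add (IHb _ bb').
  by case: (ltnP y' k) => // /(leq_ltn_trans yy') ->.
apply: prod_mean_le => [mu|b _ _].
  by rewrite mem_nseq => /andP[_ /eqP -> y]; apply: cell_law_ge0.
rewrite /stopped_potential; case: crossed => //.
by rewrite mulr_ge0 ?expR_ge0 // bridge_potential_ge0.
Qed.

End Crossing.

(** * Cells of independent random variables *)

Section Buckets.
Variables (R : realType) (s : nat -> R).
Hypotheses (s_mono : forall k, s k <= s k.+1).

(** The value is [K] when [r] is above all the thresholds [s 1, ..., s K]. *)
Definition bucket K (r : R) : nat := find (fun k => r <= s k.+1) (iota 0 K).

Lemma bucket_le K r : (bucket K r <= K)%N.
Proof. by rewrite -[X in (_ <= X)%N](size_iota 0 K) find_size. Qed.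

Lemma bucket_lt K k r : (k < K)%N -> (bucket K r < k.+1)%N = (r <= s k.+1).
Proof.
move=> kK; rewrite /bucket -has_take_leq ?size_iota // take_iota (minn_idPl kK).
apply/hasP/idP => [[i]|rs]; last by exists k => //; rewrite mem_iota /= ltnSn.
rewrite mem_iota /= add0n ltnS => ik /le_trans; apply.
by apply: (@homo_leq _ s (fun u v => u <= v)) => // u v w; apply: le_trans.
Qed.

Lemma measurable_bucket_lt K k : measurable [set r : R | (bucket K r < k)%N].
Proof.
case: k => [|k].
  by rewrite (_ : [set r | _] = set0) //; apply/seteqP; split.
have [kK|Kk] := ltnP k K.
  rewrite (_ : [set r | _] = `]-oo, s k.+1]%classic); first exact: measurable_itv.
  by apply/seteqP; split => r /=; rewrite bucket_lt // in_itv.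
rewrite (_ : [set r | _] = setT); first exact: measurableT.
by apply/seteqP; split => r //= _; rewrite ltnS (leq_trans (bucket_le K r)).
Qed.

Lemma measurable_bucket K y : measurable [set r : R | bucket K r = y].
Proof.
rewrite (_ : [set r | _] =
    [set r | (bucket K r < y.+1)%N] `\` [set r | (bucket K r < y)%N]).
  by apply: measurableD; apply: measurable_bucket_lt.
apply/seteqP; split => r /=; first by move=> ->; rewrite ltnSn ltnn.
by move=> [+ /negP]; rewrite -leqNgt ltnS => ? ?; apply/eqP; rewrite eqn_leq; apply/andP.
Qed.

Variables (d : measure_display) (T : measurableType d) (P : probability T R).
Variables (n : nat) (p : 'I_n -> {RV P >-> R}) (H0 : {set 'I_n}) (K : nat).
Hypothesis indep : mutually_independent H0 p.

Definition bucket_event j y : set T := [set w | bucket K (p j w) = y].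
Definition bucket_law j y : R := fine (P (bucket_event j y)).
Definition pattern_event (js : seq 'I_n) (g : seq nat -> bool) : set T :=
  [set w | g [seq bucket K (p j w) | j <- js]].

Lemma measurable_preimage_rv j (A : set R) :
  measurable A -> measurable (p j @^-1` A).
Proof. by move=> mA; rewrite -[X in measurable X]setTI; apply: measurable_funPT. Qed.

Lemma measurable_bucket_event j y : measurable (bucket_event j y).
Proof. exact: measurable_preimage_rv (measurable_bucket K y). Qed.

Lemma pattern_event_cons j js g : pattern_event (j :: js) g =
  \big[setU/set0]_(y < K.+1)
    (bucket_event j y `&` pattern_event js (fun b => g (nat_of_ord y :: b))).
Proof.
rewrite -(bigcup_mkord K.+1 (fun y => bucket_event j y `&`
  pattern_event js (fun b => g (y :: b)))); apply/seteqP; split => w /=.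
  by move=> gw; exists (bucket K (p j w)) => //=; rewrite ltnS bucket_le.
by move=> [y _ [/= <-]].
Qed.

Lemma measurable_pattern_event js g : measurable (pattern_event js g).
Proof.
elim: js g => [|j js IH] g.
  rewrite /pattern_event /=; case: (g [::]).
    by rewrite (_ : [set _ | _] = setT) //; apply/seteqP.
  by rewrite (_ : [set _ | _] = set0) //; apply/seteqP; split => w.
rewrite pattern_event_cons; apply: bigsetU_measurable => y _.
exact: measurableI (measurable_bucket_event j y) (IH _).
Qed.

Lemma bucket_law_ge0 j y : 0 <= bucket_law j y.
Proof. exact: fine_ge0. Qed.

Lemma bucket_event_cdf j k :
  (\sum_(0 <= y < k) bucket_law j y)%:E = P [set w | (bucket K (p j w) < k)%N].
Proof.
elim: k => [|k IH].
  by rewrite big_geq // (_ : [set w | _] = set0) ?measure0 //; apply/seteqP; split.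
rewrite big_nat_recr //= EFinD IH /bucket_law fineK ?fin_num_measure //;
  last exact: measurable_bucket_event.
rewrite -measureU.
- congr (P _); apply/seteqP; split => w /=.
    by case=> [/ltnW //|->].
  by rewrite ltnS leq_eqVlt => /orP[/eqP|]; [right|left].
- exact: measurable_preimage_rv (measurable_bucket_lt K k).
- exact: measurable_bucket_event.
- by apply/seteqP; split => w //= [+ e]; rewrite e ltnn.
Qed.

(** The variables are split off one at a time.  For the induction, the event is
    intersected with conditions on the variables [J] already treated, whose
    cells are then fixed; when none remains, independence evaluates it. *)
Lemma probability_pattern_event js g : uniq js -> {subset js <= H0} ->
  P (pattern_event js g) =
  (prod_mean K [seq bucket_law j | j <- js] (fun b => (g b)%:R))%:E.
Proof.
move=> ujs jsH0.
suff gen (J : {set 'I_n}) (A : 'I_n -> set R) : J \subset H0 ->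
    (forall j, j \in js -> j \notin J) -> (forall j, measurable (A j)) ->
    P (\bigcap_(j in [set` J]) p j @^-1` A j `&` pattern_event js g) =
    (\prod_(j in J) P (p j @^-1` A j) *
     (prod_mean K [seq bucket_law j | j <- js] (fun b => (g b)%:R))%:E)%E.
  have := gen finset.set0 (fun=> setT) (finset.sub0set _).
  rewrite big_set0 mul1e => <-; first last.
  - by move=> j; apply: measurableT.
  - by move=> j _; rewrite inE.
  by congr (P _); apply/seteqP; split => [w ?|w []//]; split => // j /=; rewrite inE.
elim: js g J A ujs jsH0 => [|j js IH] g J A /=.
  move=> _ _ JH0 _ mA; rewrite /pattern_event /=; case: (g [::]).
    by rewrite (_ : [set _ : T | true] = setT) ?setIT ?mule1 ?indep //; apply/seteqP.
  rewrite (_ : [set _ : T | false] = set0) ?setI0 ?measure0 ?mule0 //.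
  by apply/seteqP; split => w.
move=> /andP[jjs ujs] jsH0 JH0 Jjs mA.
have jJ : j \notin J by apply: Jjs; rewrite inE eqxx.
pose A' (y : nat) i := if i == j then [set r | bucket K r = y] else A i.
have mA' y i : measurable (A' y i).
  by rewrite /A'; case: eqP => _; [apply: measurable_bucket|].
pose G (y : nat) := \bigcap_(i in [set` (j |: J)%SET]) p i @^-1` A' y i `&`
  pattern_event js (fun b => g (y :: b)).
have -> : \bigcap_(i in [set` J]) p i @^-1` A i `&` pattern_event (j :: js) g =
    \big[setU/set0]_(y < K.+1) G y.
  rewrite pattern_event_cons -(bigcup_mkord K.+1 (fun y => bucket_event j y `&`
    pattern_event js (fun b => g (y :: b)))) -(bigcup_mkord K.+1 G) setI_bigcupr.
  apply: eq_bigcupr => y _; rewrite setIA; congr (_ `&` _).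
  apply/seteqP; split => w /=.
    move=> [wA wy] i /=; rewrite !inE /A'; case: eqP => [->//|_ /=]; exact: wA.
  move=> wA; split => [i /= iJ|].
    have := wA i; rewrite /= !inE iJ orbT /A'.
    by case: eqP => [ij|_ /(_ isT) //]; rewrite -ij iJ in jJ.
  by have := wA j; rewrite /= !inE eqxx /A' eqxx => /(_ isT).
have jJH0 : (j |: J)%SET \subset H0.
  by apply/fintype.subsetP => i; rewrite !inE => /orP[/eqP ->|/(fintype.subsetP JH0)//];
    apply: jsH0; rewrite inE eqxx.
rewrite measure_bigsetU_ord; first last.
- apply/trivIsetP => y z _ _ yz; apply/seteqP; split => w //= -[[wy _] [wz _]].
  have := wy j; have := wz j; rewrite /= !inE eqxx /A' eqxx => /(_ isT) ez /(_ isT) ey.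
  by move/eqP: yz; apply; apply/val_inj; rewrite /= -ez -ey.
- move=> y; apply: measurableI (measurable_pattern_event _ _).
  by apply: fin_bigcap_measurable => // i _; apply: measurable_preimage_rv.
have finX : (\prod_(i in J) P (p i @^-1` A i))%E \is a fin_num.
  rewrite -indep //; apply: fin_num_measure.
  by apply: fin_bigcap_measurable => // i _; apply: measurable_preimage_rv.
rewrite -(fineK finX) -EFinM mulr_sumr -sumEFin big_mkord.
apply: eq_bigr => y _; rewrite /G.
etransitivity; first apply: (IH _ (j |: J)%SET (A' y)) => //.
- by move=> i ijs; apply: jsH0; rewrite inE ijs orbT.
- move=> i ijs; rewrite !inE negb_or Jjs ?inE ?ijs ?orbT // andbT.
  by apply: contraNneq jjs => <-.
rewrite big_setU1 //= {1}/A' eqxx.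
rewrite (eq_bigr (fun i => P (p i @^-1` A i))); last first.
  by move=> i iJ; rewrite /A'; case: eqP => // ij; rewrite -ij iJ in jJ.
rewrite -(fineK finX) -[P _]fineK; last first.
  by apply: fin_num_measure; apply: measurable_preimage_rv (measurable_bucket _ _).
by rewrite -!EFinM /bucket_law /bucket_event /=; congr EFin; ring.
Qed.

End Buckets.

(** * From sorted p-values to thresholds *)

Section SortedRejections.
Variables (R : realType) (n : nat).
Implicit Types (v : 'I_n -> R).

Definition nulls_le (H0 : {set 'I_n}) v (t : R) : nat := #|[set i in H0 | v i <= t]%SET|.

Lemma order_stat_codom v k : exists j, order_stat v k = v j.
Proof.
have : order_stat v k \in codom v.
  by rewrite -(mem_sort <=%R) mem_nth // size_sort size_codom card_ord.
by case/codomP => j ->; exists j.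
Qed.

Lemma codom_order_stat v j : exists k, order_stat v k = v j.
Proof.
have : v j \in sort <=%R (codom v) by rewrite mem_sort codom_f.
case/(nthP 0) => i; rewrite size_sort size_codom card_ord => ilt <-.
by exists (Ordinal ilt).
Qed.

(** The denominators agree and are positive, the number of null rejections is an
    integer so that the floor can be dropped, and the order statistics take
    exactly the values of [v]. *)
Lemma FDP_le_FDPbar_sortP (H0 : {set 'I_n}) v alpha :
  (forall k, FDP H0 (rejection v k) <= FDPbar_sort alpha v k) <->
  (forall j, (nulls_le H0 v (v j))%:R <=
     ln (1 / alpha) / ln (1 + ln (1 / alpha)) * (1 + n%:R * v j)).
Proof.
suff kP k : (FDP H0 (rejection v k) <= FDPbar_sort alpha v k) =
    ((nulls_le H0 v (order_stat v k))%:R <=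
       ln (1 / alpha) / ln (1 + ln (1 / alpha)) * (1 + n%:R * order_stat v k)).
  split=> [h j|h k]; last by rewrite kP; have [j ->] := order_stat_codom v k.
  by have [k <-] := codom_order_stat v j; rewrite -kP.
have R0 : 0 < #|rejection v k|%:R :> R.
  rewrite ltr0n card_gt0; apply/set0Pn; have [j ej] := order_stat_codom v k.
  by exists j; rewrite inE ej.
rewrite /FDP /FDPbar_sort ler_pM2r ?invr_gt0 // /Vbar_sort.
have -> : #|(rejection v k :&: H0)%SET| = nulls_le H0 v (order_stat v k).
  by congr #|pred_of_set _|; apply/setP => i; rewrite !inE andbC.
by rewrite -[LHS]/(_%:Z%:~R <= _) ler_int floor_ge_int.
Qed.

End SortedRejections.

Section Thresholds.
Variables (R : realType) (n : nat) (x : R).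
Hypotheses (n_gt0 : (0 < n)%N) (x_gt1 : 1 < x).

(** The time at which the line [x * (1 + n * t)] reaches level [k], moved up to 0
    when it does so before time 0.  Capping [k] at [n] keeps all thresholds
    below 1. *)
Definition threshold (k : nat) : R := Num.max 0 (((minn k n)%:R / x - 1) / n%:R).

Let n0 : 0 < n%:R :> R. Proof. by rewrite ltr0n. Qed.
Let x0 : 0 < x. Proof. exact: lt_trans x_gt1. Qed.

Lemma threshold0 : threshold 0 = 0.
Proof.
by rewrite /threshold min0n mul0r sub0r max_l // mulr_le0_ge0 // ?invr_ge0 ?ltW // oppr_lt0.
Qed.

Lemma threshold_mono k : threshold k <= threshold k.+1.
Proof.
rewrite /threshold ge_max le_max lexx /= le_max; apply/orP; right.
rewrite ler_pM2r ?invr_gt0 // lerD2r ler_pM2r ?invr_gt0 // ler_nat.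
by rewrite leq_min geq_minr andbT (leq_trans (geq_minl _ _)).
Qed.

Lemma threshold_lt1 k : threshold k < 1.
Proof.
rewrite /threshold gt_max ltr01 /= ltr_pdivrMr // mul1r ltrBlDr.
rewrite ltr_pdivrMr //; apply: le_lt_trans (_ : n%:R < _).
  by rewrite ler_nat geq_minr.
have h : 0 < n%:R * (x - 1) by rewrite mulr_gt0 // subr_gt0.
have := x_gt1; lra.
Qed.

Lemma threshold_reached (k : nat) (t : R) :
  0 <= t -> (k <= n)%N -> x * (1 + n%:R * t) < k%:R ->
  t <= threshold k /\ x * (1 + n%:R * threshold k) = k%:R.
Proof.
move=> t0 kn xk.
have tk : t <= (k%:R / x - 1) / n%:R.
  by rewrite ler_pdivlMr // lerBrDr ler_pdivlMr // mulrC addrC [t * _]mulrC ltW.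
have -> : threshold k = (k%:R / x - 1) / n%:R.
  by rewrite /threshold (minn_idPl kn) max_r // (le_trans t0).
by split => //; field; rewrite !gt_eqF.
Qed.

End Thresholds.

(** In the form given by [FDP_le_FDPbar_sortP] the event involves only finitely
    many comparisons of random variables. *)
Lemma measurable_FDP_bound (R : realType) (d : measure_display)
    (T : measurableType d) (P : probability T R) (n : nat)
    (p : 'I_n -> {RV P >-> R}) (H0 : {set 'I_n}) (alpha : R) :
  measurable [set w | forall k : 'I_n,
     FDP H0 (rejection (fun j => p j w) k) <=
     FDPbar_sort alpha (fun j => p j w) k].
Proof.
pose c := ln (1 / alpha) / ln (1 + ln (1 / alpha)).
have mle (f g : T -> R) : measurable_fun setT f -> measurable_fun setT g ->
    measurable [set w | f w <= g w].
  move=> mf mg.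
  have := measurable_realfun.measurable_fun_ler mf mg measurableT (Y := [set true]) I.
  by rewrite setTI.
have nullsE w j : \sum_(i <- enum H0) \1_[set w | p i w <= p j w] w =
    (nulls_le H0 (fun i => p i w) (p j w))%:R :> R.
  rewrite big_enum /= /nulls_le -sum1_card natr_sum.
  rewrite [RHS](eq_bigl (fun i => (i \in H0) && (p i w <= p j w))); last first.
    by move=> i; rewrite inE.
  rewrite [RHS]big_mkcondr; apply: eq_bigr => i _.
  by rewrite indicE; case: ifPn => h; [rewrite mem_set|rewrite memNset // => /(negP h)].
rewrite (_ : [set w | _] = \bigcap_(j in [set: 'I_n]) [set w |
  \sum_(i <- enum H0) \1_[set w | p i w <= p j w] w <= c * (1 + n%:R * p j w)]).
  apply: fin_bigcap_measurable => // j _; apply: (mle).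
    apply: measurable_sum => i; apply: measurable_realfun.measurable_indic; exact: mle.
  apply: measurable_realfun.measurable_funM => //.
  apply: measurable_realfun.measurable_funD => //.
  exact: measurable_realfun.measurable_funM.
apply/seteqP; split => w.
  by move=> /FDP_le_FDPbar_sortP h j _ /=; rewrite nullsE; apply: h.
by move=> h; apply/FDP_le_FDPbar_sortP => j; have := h j I; rewrite /= nullsE.
Qed.

Theorem theorem1 (R : realType) (d : measure_display) (T : measurableType d)
    (P : probability T R) (n : nat) (p : 'I_n -> {RV P >-> R})
    (H0 : {set 'I_n})
    (p01 : forall (j : 'I_n) (w : T), 0 <= p j w <= 1)
    (indep : mutually_independent H0 p)
    (superunif : forall (j : 'I_n) (s : R), j \in H0 -> 0 <= s <= 1 ->
      (P [set w | (p j w <= s)%R] <= s%:E)%E)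
    (alpha : R) (alpha_gt0 : 0 < alpha) (alpha_le : alpha <= 31 / 100) :
  ((1 - alpha)%:E <=
     P [set w | forall k : 'I_n,
          (FDP H0 (rejection (fun j => p j w) k) <=
           FDPbar_sort alpha (fun j => p j w) k)%R])%E.
Proof.
set good := [set w | _].
have mgood : measurable good := measurable_FDP_bound p H0 alpha.
have [n0|n_gt0] := posnP n.
  rewrite (_ : good = setT) ?probability_setT ?lee_fin; first by lra.
  by apply/seteqP; split => // w _ k; have := ltn_ord k; rewrite [X in (_ < X)%N]n0.
pose L := ln (1 / alpha); pose theta := ln (1 + L); pose x := L / theta.
have La : expR L = 1 / alpha by rewrite lnK // posrE divr_gt0.
have a1 : 100 / 31 <= expR L.
  by rewrite La ler_pdivlMr // mulrC -ler_pdivlMr ?divr_gt0 //; lra.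
have L0 : 0 < L by rewrite ltNge -expR_le1 -ltNge; lra.
have theta0 : 0 < theta by rewrite ln_gt0 //; lra.
have x32 : 3 / 2 <= x by rewrite ler_pdivlMr // ratio_ge_three_halves.
have thx : theta * x = L by rewrite mulrC divfK // gt_eqF.
have eth : expR theta = 1 + theta * x by rewrite thx lnK // posrE; lra.
have x1 : 1 < x by lra.
have x_ge0 : 0 <= x by lra.
pose s := threshold n x; pose js := enum H0.
pose bad := pattern_event s p n js (crossed s #|H0| x n).
have mbad : measurable bad by apply: measurable_pattern_event; apply: threshold_mono.
have Pbad : (P bad <= alpha%:E)%E.
  rewrite (@probability_pattern_event _ s _ _ _ _ _ _ _ n indep) ?enum_uniq //;
    [|exact: threshold_mono|by move=> j; rewrite mem_enum].
  have -> : alpha = expR (- (theta * x)).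
    by rewrite thx expRN La invf_div divr1.
  rewrite lee_fin; apply: mean_crossed_le => //.
  - exact: threshold0.
  - exact: threshold_mono.
  - exact: threshold_lt1.
  - exact: ltW.
  - by rewrite size_map -cardE.
  - by move=> _ /mapP[j _ ->] y; apply: bucket_law_ge0.
  - move=> _ /mapP[j jH0 ->] k kn.
    rewrite -lee_fin bucket_event_cdf; last exact: threshold_mono.
    rewrite (_ : [set w | _] = [set w | p j w <= s k.+1]); last first.
      by apply/seteqP; split => w /=; rewrite bucket_lt //; exact: threshold_mono.
    apply: superunif; first by rewrite -mem_enum.
    rewrite (ltW (threshold_lt1 n_gt0 x1 k.+1)) andbT.
    by rewrite /s /threshold le_max lexx.
  - move=> _ /mapP[j _ ->]; apply/EFin_inj.
    rewrite bucket_event_cdf; last exact: threshold_mono.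
    rewrite (_ : [set w | _] = setT) ?probability_setT //.
    by apply/seteqP; split => // w _ /=; rewrite ltnS bucket_le.
have sub : ~` bad `<=` good.
  move=> w nbad; apply/FDP_le_FDPbar_sortP => j.
  rewrite leNgt; apply/negP => big; apply: nbad; rewrite /bad /pattern_event /=.
  set k := nulls_le _ _ _ in big.
  have kn : (k <= n)%N by rewrite (leq_trans (max_card _)) // card_ord.
  have pj0 : 0 <= p j w by case/andP: (p01 j w).
  have [pjs xk] := threshold_reached n_gt0 x1 pj0 kn big.
  apply/hasP; exists k; first by rewrite mem_iota /= add0n ltnS.
  have k_gt0 : (0 < k)%N.
    rewrite -(ltr_nat R); apply: le_lt_trans big; rewrite (mulr_ge0 x_ge0) //.
    by rewrite addr_ge0 // mulr_ge0.
  rewrite /reaches; apply: (@le_trans _ _ k%:R).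
    rewrite -xk (ler_wpM2l x_ge0) //.
    rewrite lerD2l ler_wpM2r ?ler_nat //; first exact: le_trans pjs.
    by rewrite (leq_trans (max_card _)) // card_ord.
  rewrite ler_nat /below count_map -size_filter.
  rewrite {1}/k /nulls_le cardE; apply: uniq_leq_size (enum_uniq _) _ => i.
  rewrite mem_enum inE mem_filter mem_enum => /andP[-> pij] /=; rewrite andbT.
  rewrite -(prednK k_gt0) bucket_lt ?prednK //; last exact: threshold_mono.
  exact: le_trans pjs.
apply: le_trans (_ : (P (~` bad) <= _)%E); last first.
  by apply: le_measure; rewrite ?inE //; apply: measurableC.
by rewrite probability_setC // EFinB leeB.
Qed.
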